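(* Let $0<\alpha<1$, $T>0$, and let $u(x,t)$ be the solution of $$\left(\frac{\partial}{\partial t}\pm\frac{\partial}{\partial x}\right)^{\alpha}u(x,t)=f(x,t),\quad x\in\mathbb{R},\ 0<t\le T,\qquad u(x,0)=0,\quad x\in\mathbb{R}.$$ For $h>0$ let $u_i^n$ be the solution of the numerical scheme $$u^n_{i\mp1}=\sum_{j=0}^{n-1}(b_{n-j}-b_{n-j+1})\,u^j_{i\mp(n-j+1)}+h^\alpha\,\Gamma(2-\alpha)\,f_i^n,\qquad u_i^0=0,\qquad i\in\mathbb{Z},\ t_n\le T,$$ where $b_k=k^{1-\alpha}-(k-1)^{1-\alpha}$. Assume that $f(\cdot,t)\in L^2(\mathbb{R})$ and that the truncation error of the discretization satisfies, for some $r>0$ and some constant independent of $h$ and $n$ (denoted $C$), $$\left\|\delta_\pm^\alpha u(\cdot,t_n)-\left(\frac{\partial}{\partial t}\pm\frac{\partial}{\partial x}\right)^{\alpha}u(\cdot,t_n)\right\|_{2,h}\le C h^r .$$ Then $$\|u(\cdot,t_n)-u^n\|_{2,h}\le C h^r,$$ where the (possibly different) constant $C$ depends on $\alpha$, $u$ and its derivatives (and not on $h$ or $n$), while the order $r>0$ is the one in the truncation assumption and is related to the regularity of the solution.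
   Context: The fractional material derivative is $$\left(\frac{\partial}{\partial t}\pm\frac{\partial}{\partial x}\right)^{\alpha}u(x,t)=\frac{1}{\Gamma(1-\alpha)}\left(\frac{\partial}{\partial t}\pm\frac{\partial}{\partial x}\right)\int_0^t(t-s)^{-\alpha}u\bigl(x\mp(t-s),s\bigr)\,ds.$$ The mesh is $x_i=ih$, $t_n=nh$ ($i\in\mathbb{Z}$, $n\in\mathbb{N}$), with the same step in space and time. The discrete norm is $\|v\|_{p,h}=\left(h\sum_{i\in\mathbb{Z}}|v_i|^p\right)^{1/p}$; a function $g(x,t)$ is identified with its grid values $g_i^n=g(x_i,t_n)$ (in particular $f_i^n=f(x_i,t_n)$). The discrete operator applied to grid values $v_i^n$ is $$\delta_\pm^\alpha v_i^n=\frac{h^{-\alpha}}{\Gamma(2-\alpha)}\left[v^n_{i\mp1}-\sum_{j=0}^{n-1}(b_{n-j}-b_{n-j+1})\,v^j_{i\mp(n-j+1)}\right],$$ and $\delta_\pm^\alpha u(\cdot,t_n)$ denotes its application to the grid values $u(x_i,t_m)$ of the exact solution. Upper signs are taken together, and lower signs are taken together. *)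

(* Defs.v *)
From HB Require Import structures.
From mathcomp Require Import all_boot all_order all_algebra.
From mathcomp Require Import all_classical all_reals all_analysis.

Set Implicit Arguments.
Unset Strict Implicit.
Unset Printing Implicit Defensive.

Import Order.TTheory GRing.Theory Num.Theory.
Import numFieldNormedType.Exports.

Local Open Scope classical_set_scope.
Local Open Scope ring_scope.

(* A sign choice is a boolean s: the sign "±" is (-1) ^+ s, so s = false selects
   all the upper signs and s = true all the lower ones; "∓" is - (-1) ^+ s. *)

(* Euler's integral; meaningful for a > 0. *)
Definition Gamma (R : realType) (a : R) : R :=
  (\int[@lebesgue_measure R]_(x in `]0, +oo[) (x `^ (a - 1) * expR (- x)))%R.

Section FractionalMaterialDerivative.
Variable R : realType.
Implicit Types (D : set R) (g : R -> R) (s : bool) (alpha T x t : R).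
Implicit Types (u f : R -> R -> R).

(* The derivative relative to D: two-sided in the interior of D and one-sided
   at an endpoint. Functions of time are only meaningful on [0, T], so this is
   what makes the equation at t = T independent of values beyond T. *)
Definition diff_quotient g t (z : R) : R := (z - t)^-1 * (g z - g t).

Definition derivable_on D g t : Prop :=
  cvg (diff_quotient g t z @[z --> within D t^']).

Definition derive_on D g t : R :=
  lim (diff_quotient g t z @[z --> within D t^']).

Definition material_kernel s alpha u x t (z : R) : R :=
  (t - z) `^ (- alpha) * u (x - (-1) ^+ s * (t - z)) z.

Definition material_integral s alpha u x t : R :=
  (\int[@lebesgue_measure R]_(z in `[0, t]) material_kernel s alpha u x t z)%R.

Definition frac_material_derivative s alpha T u x t : R :=
  (Gamma (1 - alpha))^-1 *
  (derive_on `[0, T] (fun z => material_integral s alpha u x z) t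
   + (-1) ^+ s * derive1 (fun y => material_integral s alpha u y t) x).

Definition frac_material_differentiable s alpha T u x t : Prop :=
  [/\ (@lebesgue_measure R).-integrable `[0, t]
        (EFin \o material_kernel s alpha u x t),
      derivable_on `[0, T] (fun z => material_integral s alpha u x z) t
    & derivable (fun y => material_integral s alpha u y t) x 1].

Definition is_solution s alpha T f u : Prop :=
  (forall x t, 0 < t -> t <= T ->
     frac_material_differentiable s alpha T u x t /\
     frac_material_derivative s alpha T u x t = f x t) /\
  (forall x, u x 0 = 0).

End FractionalMaterialDerivative.

Section Scheme.
Variable R : realType.
Implicit Types (s : bool) (alpha T h : R) (n : nat) (i : int).
Implicit Types (v : nat -> int -> R) (f g : R -> R -> R).

(* Grid values v n i stand for v_i^n. *)
Definition grid h g n i : R := g (i%:~R * h) (n%:R * h).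

(* Takes values in [0, +oo]; a bound by a finite quantity thus contains the
   convergence of the series. *)
Definition discrete_norm (p h : R) (w : int -> R) : \bar R :=
  ((h%:E * \esum_(i in [set: int]) (`|w i| `^ p)%:E) `^ p^-1)%E.

(* Only used for k >= 1. *)
Definition weight alpha (k : nat) : R :=
  k%:R `^ (1 - alpha) - (k%:R - 1) `^ (1 - alpha).

Definition history s alpha v n i : R :=
  \sum_(j < n) (weight alpha (n - j) - weight alpha (n - j + 1))
               * v j (i - (-1) ^+ s * (n - j + 1)%N%:Z).

Definition discrete_operator s alpha h v n i : R :=
  h `^ (- alpha) / Gamma (2 - alpha) *
  (v n (i - (-1) ^+ s) - history s alpha v n i).

(* The recursion is imposed for n >= 1; level 0 is the initial condition. *)
Definition is_scheme_solution s alpha T h f v : Prop :=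
  (forall n i, (0 < n)%N -> n%:R * h <= T ->
     v n (i - (-1) ^+ s) =
       history s alpha v n i
       + h `^ alpha * Gamma (2 - alpha) * grid h f n i) /\
  (forall i, v 0%N i = 0).

End Scheme.

(* Main.v *)
(* The error satisfies the scheme's recursion with source [h^alpha Gamma(2-alpha)]
   times the truncation error. The coefficients [b_k - b_{k+1}] of level [n] are
   nonnegative and sum to [1 - b_{n+1}], so convexity of the square propagates
   bounds on the squared l2 norms without Minkowski's inequality, and each level
   loses only a factor [1 / b_{n+1}]. By the mean value theorem
   [1 / b_{n+1} <= (n+1)^alpha / (1-alpha)], and [h^alpha (n+1)^alpha <= (2T)^alpha]
   absorbs this loss uniformly in [h] and [n]. *)
Require Import Defs.
From mathcomp Require Import all_boot all_order all_algebra.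
From mathcomp Require Import all_classical all_reals all_analysis.
From mathcomp Require Import measurable_realfun ring lra.

Set Implicit Arguments.
Unset Strict Implicit.
Unset Printing Implicit Defensive.

Import Order.TTheory GRing.Theory Num.Theory.
Import numFieldNormedType.Exports.

Local Open Scope classical_set_scope.
Local Open Scope ring_scope.

(** * Positivity of the Gamma integral at arguments above 1 *)

(** This is [ln y < y] at [y = x / (2 * p)]. Halving the exponent leaves integrable decay after
    multiplication by [expR (- x)]. *)
Lemma powR_le_expR_half (R : realType) (p x : R) : 0 < p -> 0 < x ->
  x `^ p <= (2 * p) `^ p * expR (x / 2).
Proof.
move=> p0 x0.
have p20 : 0 < 2 * p by rewrite mulr_gt0.
have y0 : 0 < x / (2 * p) by rewrite divr_gt0.
have -> : x `^ p = (2 * p) `^ p * (x / (2 * p)) `^ p.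
  by rewrite -powRM ?ltW// mulrC divfK// gt_eqF.
rewrite ler_wpM2l ?powR_ge0// /powR gt_eqF// ler_expR.
have -> : x / 2 = p * (x / (2 * p)).
  by field; rewrite gt_eqF.
by rewrite ler_wpM2l ?(ltW p0)// ltW// ln_sublinear.
Qed.

Lemma Gamma_integrand_measurable (R : realType) (a : R) (D : set R) :
  measurable_fun D (fun x : R => x `^ (a - 1) * expR (- x)).
Proof.
apply: measurable_funM.
  by apply: measurable_funTS; exact: measurable_powR.
apply: (@measurableT_comp _ _ _ _ _ _ expR); first exact: measurable_expR.
exact: oppr_measurable.
Qed.

Lemma Gamma_integrable (R : realType) (a : R) : 1 < a ->
  (@lebesgue_measure R).-integrable `]0, +oo[
    (fun x : R => (x `^ (a - 1) * expR (- x))%:E).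
Proof.
move=> a1; have p0 : 0 < a - 1 by rewrite subr_gt0.
(* The last factor 2 cancels the rate [2^-1] in front of the dominating exponential density. *)
pose K := (2 * (a - 1)) `^ (a - 1) * 2.
refine (@le_integrable _ _ _ (@lebesgue_measure R) `]0, +oo[%classic _
  (fun x : R => (x `^ (a - 1) * expR (- x))%:E)
  (fun x => (K%:E * (exponential_pdf (2^-1 : R) x)%:E)%E) _ _ _) => //.
- by apply/measurable_EFinP; exact: Gamma_integrand_measurable.
- move=> x /=; rewrite in_itv/= andbT => x0.
  rewrite lee_fin exponential_pdfE ?(ltW x0)//.
  rewrite !ger0_norm ?mulr_ge0 ?powR_ge0 ?expR_ge0//.
  rewrite /K [leRHS](_ : _ = (2 * (a - 1)) `^ (a - 1) * expR (x / 2) * expR (- x)).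
    by rewrite ler_wpM2r ?expR_ge0// powR_le_expR_half.
  rewrite -[RHS]mulrA -expRD (_ : x / 2 + - x = - 2^-1 * x); last by field.
  by field.
- apply: integrableZl => //.
  apply: (@integrableS _ _ _ _ setT) => //.
  by apply: integrable_exponential_pdf.
Qed.

Lemma Gamma_gt0 (R : realType) (a : R) : 1 < a -> 0 < Gamma a.
Proof.
(* Since [fine] sends infinity to 0, finiteness is needed as well; it is proved first, from
   integrability. *)
move=> a1; rewrite /Gamma /Rintegral fine_gt0//; apply/andP; split; last first.
  have /integrableP[_] := Gamma_integrable a1.
  apply: le_lt_trans; apply: ge0_le_integral => //.
  - by move=> x _; rewrite lee_fin mulr_ge0 ?powR_ge0 ?expR_ge0.
  - by apply/measurable_EFinP; exact: Gamma_integrand_measurable.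
  - by apply: measurableT_comp => //; apply/measurable_EFinP;
    exact: Gamma_integrand_measurable.
  - by move=> x _; rewrite lee_abs.
(* On [1, 2] the integrand is at least [expR (- 2)], because [a - 1] is positive. *)
apply: (@lt_le_trans _ _
  (\int[@lebesgue_measure R]_(x in `[1%R, 2%R]) cst (expR (- 2))%:E x)%E).
  rewrite integral_cst//= lebesgue_measure_itv/= lte_fin ltr1n -EFinB -EFinM lte_fin.
  by rewrite mulr_gt0 ?expR_gt0// subr_gt0 ltr1n.
apply: (@le_trans _ _ (\int[@lebesgue_measure R]_(x in `[1%R, 2%R])
    (x `^ (a - 1) * expR (- x))%:E)%E).
  apply: ge0_le_integral => //.
  - by move=> x _; rewrite lee_fin expR_ge0.
  - by apply/measurable_EFinP; exact: Gamma_integrand_measurable.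
  - move=> x /=; rewrite in_itv/= => /andP[x1 x2].
    rewrite lee_fin -[leLHS]mul1r ler_pM ?expR_ge0// ?ler_expR ?lerN2//.
    by rewrite -[leLHS](powRr0 x) ler_powR// subr_ge0 ltW.
apply: ge0_subset_integral => //.
- by apply/measurable_EFinP; exact: Gamma_integrand_measurable.
- by move=> x _; rewrite lee_fin mulr_ge0 ?powR_ge0 ?expR_ge0.
- by move=> x /=; rewrite !in_itv/= andbT => /andP[x1 _]; exact: lt_le_trans x1.
Qed.

(** * Size and monotonicity of the weights *)

Lemma weight1 (R : realType) (alpha : R) : alpha < 1 -> weight alpha 1 = 1.
Proof.
by move=> a1; rewrite /weight subrr powR1 powR0 ?subr0// subr_eq0 gt_eqF.
Qed.

(** Mean value theorem for the power of exponent [1 - alpha] on [k, k+1]; [1 <= k] keeps the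
    interval away from 0, where differentiability may fail. *)
Lemma weight_mvt (R : realType) (alpha : R) (k : nat) : (1 <= k)%N ->
  exists2 c : R, k%:R < c < k.+1%:R & weight alpha k.+1 = (1 - alpha) * c `^ (- alpha).
Proof.
move=> k1; have k0 : 0 < k%:R :> R by rewrite ltr0n.
have [|x||] := @MVT R (fun x => x `^ (1 - alpha))
  (fun x => (1 - alpha) * x `^ (1 - alpha - 1)) k%:R k.+1%:R.
- by rewrite ltr_nat.
- rewrite in_itv/= => /andP[kx _]; apply: is_derive1_powR; exact: lt_trans kx.
- apply: derivable_within_continuous => x; rewrite in_itv/= => /andP[kx _].
  by apply: derivable_powR; rewrite in_itv/= andbT; exact: lt_le_trans kx.
- move=> c; rewrite in_itv/= => kc E; exists c => //.
  rewrite /weight -[X in X - 1]natr1 addrK E.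
  by rewrite -[X in X - k%:R]natr1 [_ + 1]addrC addrK mulr1 addrAC subrr add0r.
Qed.

Lemma le_weight (R : realType) (alpha : R) (k : nat) :
  0 < alpha -> alpha < 1 -> (1 <= k)%N ->
  (1 - alpha) * k%:R `^ (- alpha) <= weight alpha k.
Proof.
(* Index 1 is treated apart, since its interval [0, 1] touches the origin. *)
move=> a0 a1; case: k => // -[_|k _].
  by rewrite weight1// powR1 mulr1 gerBl ltW.
have [//|c /andP[kc ck] ->] := @weight_mvt R alpha k.+1.
rewrite ler_wpM2l ?subr_ge0 ?(ltW a1)// !powRN lef_pV2 ?posrE ?powR_gt0//.
- by rewrite ge0_ler_powR ?nnegrE ?(ltW a0) ?(ltW ck)// ltW// (le_lt_trans _ kc).
- by rewrite (le_lt_trans _ kc).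
Qed.

Lemma weight_le (R : realType) (alpha : R) (k : nat) :
  0 < alpha -> alpha < 1 -> (1 <= k)%N ->
  weight alpha k.+1 <= (1 - alpha) * k%:R `^ (- alpha).
Proof.
move=> a0 a1 k1.
have [//|c /andP[kc ck] ->] := @weight_mvt R alpha k.
have k0 : 0 < k%:R :> R by rewrite ltr0n.
rewrite ler_wpM2l ?subr_ge0 ?(ltW a1)// !powRN lef_pV2 ?posrE ?powR_gt0//.
- by rewrite ge0_ler_powR ?nnegrE ?(ltW a0) ?(ltW kc) ?(ltW k0)// ltW// (lt_trans k0).
- exact: lt_trans kc.
Qed.

(** The value (1 - alpha) k^(-alpha) separates the two weights. This makes the coefficients of
    [history] nonnegative. *)
Lemma weightS_le (R : realType) (alpha : R) (k : nat) :
  0 < alpha -> alpha < 1 -> (1 <= k)%N ->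
  weight alpha k.+1 <= weight alpha k.
Proof.
by move=> a0 a1 k1; apply: le_trans (weight_le a0 a1 k1) (le_weight a0 a1 k1).
Qed.

Lemma weight_le_anti (R : realType) (alpha : R) (k m : nat) : 0 < alpha -> alpha < 1 ->
  (1 <= k)%N -> (k <= m)%N -> weight alpha m <= weight alpha k.
Proof.
move=> a0 a1 k1 /subnK <-; elim: (m - k)%N => [|d IH]//.
by apply: le_trans IH; rewrite addSn weightS_le// (leq_trans k1)// leq_addl.
Qed.

Lemma weight_gt0 (R : realType) (alpha : R) (k : nat) :
  0 < alpha -> alpha < 1 -> (1 <= k)%N ->
  0 < weight alpha k.
Proof.
move=> a0 a1 k1; apply: lt_le_trans (le_weight a0 a1 k1).
by rewrite mulr_gt0 ?subr_gt0// powR_gt0// ltr0n.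
Qed.

(** The sum telescopes once its order is reversed. The last weight is the share left for the source
    term in a convex combination. *)
Lemma sum_weight_diff (R : realType) (alpha : R) (n : nat) : alpha < 1 ->
  \sum_(j < n) (weight alpha (n - j) - weight alpha (n - j + 1))
    + weight alpha n.+1 = 1.
Proof.
move=> a1; rewrite (reindex_inj rev_ord_inj)/=.
rewrite (eq_bigr (fun j : 'I_n => weight alpha j.+1 - weight alpha j.+2)); last first.
  by move=> j _; rewrite subKn// addn1.
elim: n => [|n IH]; first by rewrite big_ord0 add0r weight1.
by rewrite big_ord_recr/= -addrA subrK IH.
Qed.

(** * Squared l2 norms of sequences indexed by the integers *)

Section SquareNorm.
Variable R : realType.
Implicit Types (w : int -> R).

Definition sqnorm w : \bar R := \esum_(i in [set: int]) (w i ^+ 2)%:E.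

Lemma sqnorm_ge0 w : (0 <= sqnorm w)%E.
Proof. by apply: esum_ge0 => i _; rewrite lee_fin sqr_ge0. Qed.

(** Translation permutes the integers, so the shifts along characteristics cost nothing, for either
    sign. *)
Lemma sqnorm_shift k w : sqnorm (fun i => w (i - k)) = sqnorm w.
Proof.
rewrite /sqnorm [RHS](@reindex_esum _ _ _ setT setT (fun i : int => i - k))//.
split=> //.
- by move=> x y _ _ /addIr.
- by move=> y _; exists (y + k) => //; rewrite addrK.
Qed.

Lemma esumZ_le (T : choiceType) (c : R) (a : T -> \bar R) : 0 <= c ->
  (forall i, (0 <= a i)%E) ->
  (\esum_(i in [set: T]) (c%:E * a i) <= c%:E * \esum_(i in [set: T]) a i)%E.
Proof.
move=> c0 a0; apply: ge_ereal_sup => _ [X [finX XT] <-].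
rewrite -ge0_mule_fsumr// lee_wpmul2l ?lee_fin//.
by apply: esum_ge; exists X.
Qed.

(** Jensen's inequality for the square: the points are [x j] with weight [c j] and [y / b] with
    weight [b], and [m] is their mean. *)
Lemma sqr_convex n (c x : 'I_n -> R) (b y : R) : (forall j, 0 <= c j) -> 0 < b ->
  \sum_j c j + b = 1 ->
  (\sum_j c j * x j + y) ^+ 2 <= \sum_j c j * x j ^+ 2 + b^-1 * y ^+ 2.
Proof.
move=> c0 b0 cb1; set m := \sum_j _ + y.
(* This variance equals the right side minus the left side of the claim. *)
have : 0 <= \sum_j c j * (x j - m) ^+ 2 + b * (y / b - m) ^+ 2.
  by rewrite addr_ge0 ?sumr_ge0// => [j _|]; rewrite mulr_ge0 ?sqr_ge0// ltW.
rewrite (eq_bigr (fun j => c j * x j ^+ 2 - 2 * m * (c j * x j) + m ^+ 2 * c j)); last first.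
  by move=> j _; ring.
rewrite !big_split/= sumrN -!mulr_sumr.
have -> : \sum_j c j * x j = m - y by rewrite addrK.
have -> : \sum_j c j = 1 - b by rewrite -cb1 addrK.
set S := \sum_j _ => H; rewrite -subr_ge0; apply: le_trans H _.
rewrite le_eqVlt; apply/orP; left; apply/eqP.
by field; rewrite gt_eqF.
Qed.

Lemma sqnorm_convex n (c : 'I_n -> R) (x : 'I_n -> int -> R) (b : R) y :
  (forall j, 0 <= c j) -> 0 < b -> \sum_j c j + b = 1 ->
  (sqnorm (fun i => \sum_j c j * x j i + y i)%R
    <= \sum_j (c j)%:E * sqnorm (x j) + b^-1%:E * sqnorm y)%E.
Proof.
move=> c0 b0 cb1.
apply: (@le_trans _ _ (\esum_(i in [set: int])
    (\sum_j (c j)%:E * (x j i ^+ 2)%:E + b^-1%:E * (y i ^+ 2)%:E))%E).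
  apply: le_esum => i _.
  have -> : (\sum_j (c j)%:E * (x j i ^+ 2)%:E = (\sum_j c j * x j i ^+ 2)%:E)%E.
    by rewrite -sumEFin.
  by rewrite -EFinM -EFinD lee_fin sqr_convex.
rewrite esumD; last 2 first.
- by move=> i _; apply: sume_ge0 => j _; rewrite mule_ge0 ?lee_fin ?sqr_ge0.
- by move=> i _; rewrite mule_ge0 ?lee_fin ?sqr_ge0 ?invr_ge0 ?ltW.
rewrite esum_sum; last by move=> i j _ _; rewrite mule_ge0 ?lee_fin ?sqr_ge0.
apply: leeD; last by apply: esumZ_le => [|i]; rewrite ?invr_ge0 ?(ltW b0)// lee_fin sqr_ge0.
by apply: lee_sum => j _; apply: esumZ_le => // i; rewrite lee_fin sqr_ge0.
Qed.

Lemma discrete_norm2_le (h c : R) w : 0 < h -> 0 <= c ->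
  (discrete_norm 2 h w <= c%:E)%E = (sqnorm w <= (c ^+ 2 / h)%:E)%E.
Proof.
move=> h0 c0; rewrite /discrete_norm.
rewrite (_ : \esum_(i in _) _ = sqnorm w); last first.
  by apply: eq_esum => i _; rewrite powR_mulrn// real_normK ?num_real.
(* If the series diverges, both inequalities are false. *)
have := sqnorm_ge0 w; case: (sqnorm w) => [x|_|//]; last first.
  by rewrite gt0_muley ?lte_fin// poweRyr ?invr_eq0// !leye_eq.
rewrite lee_fin => x0; rewrite -EFinM poweR_EFin !lee_fin.
rewrite ler_pdivlMr// mulrC powR12_sqrt ?mulr_ge0 ?(ltW h0)//.
by rewrite -{1}(ger0_norm c0) -sqrtr_sqr ler_sqrt ?sqr_ge0.
Qed.

End SquareNorm.

(** * Stability of the recursion *)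

(* With [b] the weight of index [n.+1], convexity gives the bound
   [(1 - b) * (M / b ^+ 2) + M / b], which is exactly [M / b ^+ 2]. *)
Lemma scheme_stability (R : realType) (s : bool) (alpha M : R) (N : nat)
    (e tau : nat -> int -> R) :
  0 < alpha -> alpha < 1 ->
  (forall i, e 0%N i = 0) ->
  (forall n i, (0 < n <= N)%N ->
     e n (i - (-1) ^+ s) = history s alpha e n i + tau n i) ->
  (forall n, (0 < n <= N)%N -> (sqnorm (tau n) <= M%:E)%E) ->
  0 <= M ->
  forall n, (n <= N)%N -> (sqnorm (e n) <= (M / weight alpha n.+1 ^+ 2)%:E)%E.
Proof.
move=> a0 a1 e0 erec tauM M0; elim/ltn_ind => -[_ _|n IH nN].
  rewrite weight1// expr1n divr1 /sqnorm esum1 ?lee_fin// => i _.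
  by rewrite e0 expr0n.
have b0 := @weight_gt0 R alpha n.+2 a0 a1 isT; set b := weight _ _ in b0 *.
(* The recursion gives the new level at shifted indices, so the norm is translated to match. *)
rewrite -(sqnorm_shift ((-1) ^+ s)).
rewrite (_ : (fun i => _) = fun i => history s alpha e n.+1 i + tau n.+1 i); last first.
  by apply/funext => i; rewrite erec.
rewrite /history.
have c0 (j : 'I_n.+1) : 0 <= weight alpha (n.+1 - j) - weight alpha (n.+1 - j + 1).
  by rewrite subr_ge0 addn1 weightS_le// subn_gt0.
apply: (le_trans (sqnorm_convex
  (fun (j : 'I_n.+1) i => e j (i - (-1) ^+ s * (n.+1 - j + 1)%N%:Z)) _
  c0 b0 (sum_weight_diff n.+1 a1))).
apply: (@le_trans _ _ (\sum_(j < n.+1)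
    (weight alpha (n.+1 - j) - weight alpha (n.+1 - j + 1))%:E * (M / b ^+ 2)%:E
    + b^-1%:E * M%:E)%E).
  apply: leeD; last by rewrite lee_wpmul2l ?lee_fin ?invr_ge0 ?(ltW b0)// tauM.
  apply: lee_sum => j _; rewrite lee_wpmul2l ?lee_fin// sqnorm_shift.
  apply: (le_trans (IH j (ltn_ord j) (ltnW (leq_trans (ltn_ord j) nN)))).
  (* Weights decrease, so the bound at level [j], whose weight has index [j.+1], is at most the one
     with [b]. *)
  rewrite lee_fin ler_wpM2l// lef_pV2 ?posrE ?exprn_gt0 ?weight_gt0//.
  rewrite ler_pXn2r ?nnegrE ?(ltW (weight_gt0 _ _ _))//.
  by rewrite weight_le_anti// ltnS ltnW// ltnS ltn_ord.
under eq_bigr do rewrite -EFinM.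
rewrite sumEFin -EFinM -EFinD lee_fin -mulr_suml.
have -> : \sum_(j < n.+1) (weight alpha (n.+1 - j) - weight alpha (n.+1 - j + 1)) = 1 - b.
  by rewrite -(sum_weight_diff n.+1 a1) addrK.
rewrite le_eqVlt; apply/orP; left; apply/eqP.
by field; rewrite gt_eqF.
Qed.

(** * Error equation and convergence *)

Lemma historyB (R : realType) (s : bool) (alpha : R) (v w : nat -> int -> R) n i :
  history s alpha (fun n i => v n i - w n i) n i =
  history s alpha v n i - history s alpha w n i.
Proof. by rewrite /history -sumrB; apply: eq_bigr => j _; rewrite mulrBr. Qed.

Lemma sqnormZ_le (R : realType) (c : R) (w : int -> R) :
  (sqnorm (fun i => c * w i)%R <= (c ^+ 2)%:E * sqnorm w)%E.
Proof.
rewrite /sqnorm; under eq_esum do rewrite exprMn EFinM.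
by apply: esumZ_le => [|i]; rewrite ?lee_fin sqr_ge0.
Qed.

Lemma inv_weight_le (R : realType) (alpha T h : R) (n : nat) :
  0 < alpha -> alpha < 1 -> 0 < h -> (0 < n)%N -> n%:R * h <= T ->
  h `^ alpha / weight alpha n.+1 <= (2 * T) `^ alpha / (1 - alpha).
Proof.
move=> a0 a1 h0 n0 nT.
have n1 : 0 < n.+1%:R :> R by rewrite ltr0n.
rewrite ler_pdivrMr ?weight_gt0//; apply: (@le_trans _ _
  ((2 * T) `^ alpha / (1 - alpha) * ((1 - alpha) * n.+1%:R `^ (- alpha)))); last first.
  by rewrite ler_wpM2l ?le_weight// mulr_ge0 ?powR_ge0// invr_ge0 subr_ge0 ltW.
rewrite mulrA divfK ?subr_eq0 ?gt_eqF// powRN ler_pdivlMr ?powR_gt0//.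
rewrite -powRM ?(ltW h0)//.
rewrite ge0_ler_powR ?nnegrE ?(ltW a0)//.
- by rewrite mulr_ge0 ?(ltW h0)// ltW.
- by rewrite mulr_ge0// (le_trans _ nT)// mulr_ge0// ltW.
(* As [n] is positive, n + 1 <= 2 n; hence the factor 2 in front of [T]. *)
apply: (@le_trans _ _ (2 * (n%:R * h))); last by rewrite ler_wpM2l.
rewrite mulrA mulrC ler_wpM2r ?(ltW h0)// -natrM ler_nat.
by rewrite mul2n -addnn -addn1 leq_add2l.
Qed.

Theorem theorem3 (R : realType) (s : bool) (alpha T r C : R)
    (f u : R -> R -> R)
    (alpha_gt0 : 0 < alpha) (alpha_lt1 : alpha < 1) (T_gt0 : 0 < T)
    (u_sol : is_solution s alpha T f u)
    (f_L2 : forall t : R, 0 < t -> t <= T ->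
       (fun x : R => f x t) \in Lfun (@lebesgue_measure R) 2%:E)
    (r_gt0 : 0 < r)
    (truncation : forall (h : R) (n : nat),
       0 < h -> (0 < n)%N -> n%:R * h <= T ->
       (discrete_norm 2 h (fun i : int => (
          discrete_operator s alpha h (grid h u) n i
          - grid h (frac_material_derivative s alpha T u) n i)%R)
        <= (C * h `^ r)%:E)%E) :
  exists C' : R, forall (h : R) (v : nat -> int -> R),
    0 < h -> is_scheme_solution s alpha T h f v ->
    forall n : nat, n%:R * h <= T ->
    (discrete_norm 2 h (fun i : int => (grid h u n i - v n i)%R)
     <= (C' * h `^ r)%:E)%E.
Proof.
case: u_sol => u_eq u0; set G := Gamma (2 - alpha).
have G0 : 0 < G by apply: Gamma_gt0; lra.
(* The factor [G] comes from the source of the scheme and the last one from [inv_weight_le]. The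
   absolute value covers a [C] of unknown sign. *)
pose K := G * `|C| * ((2 * T) `^ alpha / (1 - alpha)).
have K0 : 0 <= K.
  by rewrite !mulr_ge0 ?powR_ge0 ?invr_ge0 ?(ltW G0)// subr_ge0 ltW.
exists K => h v h0 [v_eq v0] n nT.
have hr0 : 0 <= h `^ r by exact: powR_ge0.
have ha0 : 0 < h `^ alpha by exact: powR_gt0.
rewrite discrete_norm2_le//; last exact: mulr_ge0.
pose e n i := grid h u n i - v n i.
pose t n i := discrete_operator s alpha h (grid h u) n i
              - grid h (frac_material_derivative s alpha T u) n i.
pose tau n i := h `^ alpha * G * t n i.
have e0 i : e 0%N i = 0 by rewrite /e v0 /grid mul0r u0 subrr.
(* Level 0 is settled by the initial conditions, as the truncation bound starts at level 1. *)
have [->|n0] := posnP n.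
  rewrite /sqnorm esum1 ?lee_fin ?divr_ge0 ?sqr_ge0 ?(ltW h0)// => i _.
  by rewrite -/(e _ _) e0 expr0n.
have mT m : (m <= n)%N -> m%:R * h <= T.
  by move=> mn; apply: le_trans nT; rewrite ler_wpM2r ?(ltW h0)// ler_nat.
have e_eq m i : (0 < m <= n)%N ->
    e m (i - (-1) ^+ s) = history s alpha e m i + tau m i.
  move=> /andP[m0 mn].
  have mh0 : 0 < m%:R * h by rewrite mulr_gt0// ltr0n.
  rewrite historyB /e v_eq ?mT// /tau /t /discrete_operator
    [grid h (frac_material_derivative _ _ _ _) m i]/grid.
  (* The differential equation at the grid point turns the material derivative inside [t] into [f],
     which cancels the source of the scheme. *)
  have [_ ->] := u_eq (i%:~R * h) _ mh0 (mT _ mn).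
  rewrite powRN [grid h f m i]/grid -/G; field.
  by rewrite !gt_eqF.
have tauM m : (0 < m <= n)%N ->
    (sqnorm (tau m) <= ((G * h `^ alpha * `|C| * h `^ r) ^+ 2 / h)%:E)%E.
  move=> /andP[m0 mn]; apply: (le_trans (sqnormZ_le _ _)).
  have : (discrete_norm 2 h (t m) <= (`|C| * h `^ r)%:E)%E.
    apply: (le_trans (truncation h m h0 m0 (mT _ mn))).
    by rewrite lee_fin ler_wpM2r// ler_norm.
  rewrite discrete_norm2_le ?mulr_ge0// => tm.
  apply: (le_trans (lee_wpmul2l _ tm)); first by rewrite lee_fin sqr_ge0.
  rewrite -EFinM lee_fin le_eqVlt; apply/orP; left; apply/eqP.
  by field; rewrite gt_eqF.
apply: (le_trans (scheme_stability alpha_gt0 alpha_lt1 e0 e_eq tauM _ (leqnn n))).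
  by rewrite divr_ge0 ?sqr_ge0 ?(ltW h0).
have b0 := weight_gt0 alpha_gt0 alpha_lt1 (ltn0Sn n).
rewrite lee_fin mulrAC ler_wpM2r ?invr_ge0 ?(ltW h0)// -expr_div_n.
rewrite ler_pXn2r ?nnegrE//; last 2 first.
- by rewrite divr_ge0 ?(ltW b0)// !mulr_ge0 ?(ltW G0) ?(ltW ha0).
- by rewrite mulr_ge0.
(* Grouping the power of [h] from the source with the inverse weight isolates the only factor still
   to be bounded uniformly. *)
rewrite [leLHS](_ : _ = G * `|C| * (h `^ alpha / weight alpha n.+1) * h `^ r); last first.
  by field; rewrite gt_eqF.
rewrite ler_wpM2r// /K ler_wpM2l ?mulr_ge0 ?(ltW G0)//.
exact: inv_weight_le.
Qed.
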